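(* Let $n>0$, and let $F:\mathbb{R}\to\mathbb{R}$ be a continuous weak solution of the equation $$F^{(4)} = F - |F|^{-\frac{n}{n+1}}F \quad \text{in } \mathbb{R}$$ such that $F(y)\to 0$ as $|y|\to\infty$. Then $F$ is compactly supported in $\mathbb{R}$.
   Context: The nonlinearity $|F|^{-\frac{n}{n+1}}F$ means $|F|^{\frac{1}{n+1}}\,\mathrm{sign}\,F$; it is continuous and equals $0$ at $F=0$. Weak solution is understood in the sense of distributions: for every $\phi\in C_c^\infty(\mathbb{R})$, $\int_{\mathbb{R}} F\phi^{(4)}\,dy=\int_{\mathbb{R}}\big(F-|F|^{-\frac{n}{n+1}}F\big)\phi\,dy$. *)

(* Defs.v *)
From Stdlib Require Import Reals.
From Coquelicot Require Import Coquelicot.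

Open Scope R_scope.

(* The nonlinearity |u|^{-n/(n+1)} u, read as |u|^{1/(n+1)} sign u. Since
   [sign 0 = 0], its value at 0 is 0 whatever [Rpower 0 _] is. *)
Definition nonlinearity (n u : R) : R :=
  Rpower (Rabs u) (/ (n + 1)) * sign u.

Definition support (f : R -> R) : R -> Prop :=
  adherence (fun y => f y <> 0).

Definition compactly_supported (f : R -> R) : Prop :=
  compact (support f).

Definition test_function (phi : R -> R) : Prop :=
  (forall (k : nat) (y : R), ex_derive_n phi k y) /\ compactly_supported phi.

(* Used only for continuous integrands with compact support, for which the
   improper Riemann integral exists and is the Lebesgue integral. *)
Definition integral_line (f : R -> R) : R :=
  RInt_gen f (Rbar_locally m_infty) (Rbar_locally p_infty).

Definition weak_solution (n : R) (F : R -> R) : Prop :=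
  forall phi : R -> R, test_function phi ->
    integral_line (fun y => F y * Derive_n phi 4 y) =
    integral_line (fun y => (F y - nonlinearity n (F y)) * phi y).

(* Main.v *)
Require Import Defs.
From Stdlib Require Import Reals Lra Lia.
From Coquelicot Require Import Coquelicot.

Open Scope R_scope.

(** Write g for the nonlinearity, alpha = 1/(n+1) < 1 for its exponent, and
    f = F - g(F).

    Regularity.  Let P be a fourfold primitive of f; then u = F - P is
    continuous and annihilates every fourth derivative of a test function.
    Applied to the right combinations of translated mollifiers, this says that
    u is equal to its cubic Lagrange interpolant at 0, 1, 2, 3
    ([cubic_of_annihilating]), so that F is a classical solution of the
    equation ([classical_of_weak]).

    Extinction.  F and F'''' = F - g(F) tend to 0, hence so do F', F'', F'''
    ([vanishing_derivatives]).  Put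

      G = F F''' - F' F'',   so that   G' = - D,   D = F''^2 + F (g(F) - F).

    Where F is small, F g(F) = |F|^(1+alpha) dominates F^2, so that
    D >= (F''^2 + F g(F)) / 2 >= 0 and G decreases to 0: G(y) is the energy of
    F beyond y.  Two estimates close on each other.  Testing the equation with
    F times a cutoff supported beyond y and equal to 1 beyond y + t
    ([cutoff_inequality]) bounds t^4 G(y+t), up to a constant factor, by
    the integral of F^2 + |F F''| over [y, y+t].  Now F^2 is |F|^(1-alpha)
    times F g(F), and |F F''| is at most |F|^((1-alpha)/2) times the mean of
    F g(F) and F''^2; both are small against D because alpha < 1, whence

      t^4 G(y+t) <= C (sup |F|)^((1-alpha)/2) G(y),

    the supremum being taken beyond y.  On the other hand F' is bounded, so F
    cannot be large at a point without carrying energy around it: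
    |F(y)|^3 <= 16 G(y) ([cube_le_energy]).  Together,
    t^4 G(y+t) <= C G(y)^(1+q) with q > 0, and such a superlinear decay forces
    G to vanish at a finite point, by iteration over steps of geometrically
    decreasing length ([superlinear_decay_vanishes]).  Beyond that point
    |F|^3 <= 16 G = 0.  Near minus infinity the same argument applies to the
    reflection of F, since the equation is of even order. *)

(** * Chains of four derivatives *)

Definition derivatives4 (f f1 f2 f3 f4 : R -> R) : Prop :=
  forall x, is_derive f x (f1 x) /\ is_derive f1 x (f2 x) /\
            is_derive f2 x (f3 x) /\ is_derive f3 x (f4 x).

Lemma derivatives4_Derive_n (f f1 f2 f3 f4 : R -> R) :
  derivatives4 f f1 f2 f3 f4 ->
  (forall x, Derive_n f 1 x = f1 x) /\ (forall x, Derive_n f 2 x = f2 x) /\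
  (forall x, Derive_n f 3 x = f3 x) /\ (forall x, Derive_n f 4 x = f4 x).
Proof.
  intro H.
  assert (step : forall k g g', (forall x, Derive_n f k x = g x) ->
            (forall x, is_derive g x (g' x)) ->
            forall x, Derive_n f (S k) x = g' x).
  { intros k g g' e d x; transitivity (Derive g x).
    - apply Derive_ext; exact e.
    - apply is_derive_unique, d. }
  assert (E1 := step 0%nat f f1 (fun _ => eq_refl) (fun x => proj1 (H x))).
  assert (E2 := step 1%nat f1 f2 E1 (fun x => proj1 (proj2 (H x)))).
  assert (E3 := step 2%nat f2 f3 E2 (fun x => proj1 (proj2 (proj2 (H x))))).
  assert (E4 := step 3%nat f3 f4 E3 (fun x => proj2 (proj2 (proj2 (H x))))).
  auto.
Qed.

(** Used both with a small fourth derivative, to control the intermediate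
    derivatives, and with a vanishing one, to recognise cubic polynomials. *)
Lemma taylor4 (f f1 f2 f3 f4 : R -> R) (x h : R) :
  derivatives4 f f1 f2 f3 f4 -> 0 < h ->
  exists z, x < z < x + h /\
    f (x + h) = f x + h * f1 x + h ^ 2 / 2 * f2 x + h ^ 3 / 6 * f3 x
                + h ^ 4 / 24 * f4 z.
Proof.
  intros H hh.
  destruct (derivatives4_Derive_n _ _ _ _ _ H) as [E1 [E2 [E3 E4]]].
  destruct (Taylor_Lagrange f 3 x (x + h)) as [z [hz e]].
  - lra.
  - intros t _ k hk.
    destruct k as [|[|[|[|[|k]]]]]; [exact I| | | | |lia].
    + exists (f1 t); apply H.
    + apply ex_derive_ext with f1; [intro; symmetry; apply E1|].
      exists (f2 t); apply H.
    + apply ex_derive_ext with f2; [intro; symmetry; apply E2|].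
      exists (f3 t); apply H.
    + apply ex_derive_ext with f3; [intro; symmetry; apply E3|].
      exists (f4 t); apply H.
  - exists z; split; [exact hz|].
    rewrite e; cbn [sum_f_R0]; rewrite E1, E2, E3, E4.
    replace (x + h - x) with h by ring.
    cbn [Derive_n Factorial.fact INR Nat.mul Nat.add]; simpl pow; field.
Qed.

Lemma derivatives4_minus_scal (f f1 f2 f3 f4 g g1 g2 g3 g4 : R -> R) (c : R) :
  derivatives4 f f1 f2 f3 f4 -> derivatives4 g g1 g2 g3 g4 ->
  derivatives4 (fun x => f x - c * g x) (fun x => f1 x - c * g1 x)
    (fun x => f2 x - c * g2 x) (fun x => f3 x - c * g3 x)
    (fun x => f4 x - c * g4 x).
Proof.
  assert (K : forall (h k : R -> R) (x a b : R),
    is_derive h x a -> is_derive k x b ->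
    is_derive (fun x => h x - c * k x) x (a - c * b)).
  { intros h k x a b dh dk.
    apply (is_derive_minus h (fun x => c * k x)); [exact dh|].
    exact (is_derive_scal k x c b dk). }
  intros Hf Hg x; destruct (Hf x) as [? [? [? ?]]], (Hg x) as [? [? [? ?]]].
  split; [|split; [|split]]; apply K; assumption.
Qed.

Lemma is_derive_affine (f : R -> R) (a b x l : R) :
  is_derive f (a * x + b) l -> is_derive (fun t => f (a * t + b)) x (a * l).
Proof.
  intro d. apply (is_derive_comp f (fun t => a * t + b)); [exact d|].
  auto_derive; [exact I|ring].
Qed.

Lemma derivatives4_translate (f f1 f2 f3 f4 : R -> R) (z : R) :
  derivatives4 f f1 f2 f3 f4 ->
  derivatives4 (fun x => f (x - z)) (fun x => f1 (x - z))
    (fun x => f2 (x - z)) (fun x => f3 (x - z)) (fun x => f4 (x - z)).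
Proof.
  assert (K : forall (g : R -> R) (x l : R),
    is_derive g (x - z) l -> is_derive (fun x => g (x - z)) x l).
  { intros g x l dg.
    apply is_derive_ext with (fun t => g (1 * t + - z)).
    - intro t; f_equal; ring.
    - rewrite <- (Rmult_1_l l); apply is_derive_affine.
      replace (1 * x + - z) with (x - z) by ring; exact dg. }
  intros H x; destruct (H (x - z)) as [? [? [? ?]]].
  split; [|split; [|split]]; apply K; assumption.
Qed.

Lemma derivatives4_affine (f f1 f2 f3 f4 : R -> R) (a b : R) :
  derivatives4 f f1 f2 f3 f4 ->
  derivatives4 (fun x => f (a * x + b)) (fun x => a * f1 (a * x + b))
    (fun x => a ^ 2 * f2 (a * x + b)) (fun x => a ^ 3 * f3 (a * x + b))
    (fun x => a ^ 4 * f4 (a * x + b)).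
Proof.
  assert (K : forall (c d : R) (g : R -> R) (x l : R), d = c * a ->
    is_derive g (a * x + b) l -> is_derive (fun t => c * g (a * t + b)) x (d * l)).
  { intros c d g x l -> dg. rewrite Rmult_assoc.
    apply (is_derive_scal (fun t => g (a * t + b))), is_derive_affine, dg. }
  intros H x; destruct (H (a * x + b)) as [d0 [d1 [d2 d3]]].
  split; [apply is_derive_affine, d0|].
  split; [|split]; apply K; auto; ring.
Qed.

Lemma continuous_of_derive (f : R -> R) (x l : R) :
  is_derive f x l -> continuous f x.
Proof. intro d; apply (ex_derive_continuous f); exists l; exact d. Qed.

Lemma nondecreasing_of_derive (f f' : R -> R) (a b : R) :
  a <= b ->
  (forall x, a <= x <= b -> is_derive f x (f' x)) ->
  (forall x, a <= x <= b -> 0 <= f' x) -> f a <= f b.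
Proof.
  intros hab hd hp.
  destruct (MVT_gen f a b f') as [c [hc e]].
  - rewrite Rmin_left, Rmax_right by exact hab; intros; apply hd; lra.
  - rewrite Rmin_left, Rmax_right by exact hab; intros x hx.
    apply continuity_pt_filterlim, (continuous_of_derive f _ (f' x)), hd; lra.
  - rewrite Rmin_left, Rmax_right in hc by exact hab.
    assert (0 <= f' c * (b - a)) by (apply Rmult_le_pos; [apply hp|]; lra).
    lra.
Qed.

Lemma ex_primitive (f : R -> R) (a : R) :
  (forall x, continuous f x) ->
  exists g, (forall x, is_derive g x (f x)) /\ g a = 0.
Proof.
  intro hc; exists (fun x => RInt f a x); split.
  - intro x; apply (is_derive_RInt f (fun x => RInt f a x) a x); [|apply hc].
    exists (mkposreal 1 Rlt_0_1); intros y _.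
    apply (RInt_correct f), (ex_RInt_continuous f); auto.
  - exact (RInt_point a f).
Qed.

Lemma ex_primitive4 (f : R -> R) (a : R) :
  (forall x, continuous f x) ->
  exists g g1 g2 g3, derivatives4 g g1 g2 g3 f /\
    g a = 0 /\ g1 a = 0 /\ g2 a = 0 /\ g3 a = 0.
Proof.
  intro hc.
  assert (K : forall g g' : R -> R, (forall x, is_derive g x (g' x)) ->
            forall x, continuous g x).
  { intros g g' d x; exact (continuous_of_derive g x _ (d x)). }
  destruct (ex_primitive f a hc) as [g3 [d3 e3]].
  destruct (ex_primitive g3 a (K _ _ d3)) as [g2 [d2 e2]].
  destruct (ex_primitive g2 a (K _ _ d2)) as [g1 [d1 e1]].
  destruct (ex_primitive g1 a (K _ _ d1)) as [g [d0 e0]].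
  exists g, g1, g2, g3; split; [|auto].
  intro x; auto.
Qed.

(** * Functions with bounded support *)

Lemma compactly_supported_of_vanishing (f : R -> R) (a b : R) :
  (forall x, x < a \/ b < x -> f x = 0) -> compactly_supported f.
Proof.
  intro h. apply compact_P4 with (fun c => a <= c <= b).
  - apply compact_P3.
  - apply adherence_P3.
  - assert (K : forall x d, adherence (fun y => f y <> 0) x -> 0 < d ->
                  exists y, Rabs (y - x) < d /\ f y <> 0).
    { intros x d hx hd.
      destruct (hx (disc x (mkposreal d hd))) as [y [h1 h2]].
      - exists (mkposreal d hd); intros z hz; exact hz.
      - exists y; auto. }
    intros x hx; split; apply Rnot_lt_le; intro hlt.
    + destruct (K x (a - x) hx) as [y [h1 h2]]; [lra|].
      apply Rabs_lt_between' in h1; apply h2, h; lra.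
    + destruct (K x (x - b) hx) as [y [h1 h2]]; [lra|].
      apply Rabs_lt_between' in h1; apply h2, h; lra.
Qed.

Lemma integral_line_eq_RInt (f : R -> R) (a b : R) :
  (forall x, x < a \/ b < x -> f x = 0) -> a <= b ->
  (forall x, continuous f x) -> integral_line f = RInt f a b.
Proof.
  intros h hab hc. unfold integral_line.
  apply is_RInt_gen_unique.
  intros P hP.
  apply Filter_prod with (fun x => x < a) (fun x => b < x).
  - exists a; auto.
  - exists b; auto.
  - intros x y hx hy; exists (RInt f a b); split; [simpl|apply locally_singleton, hP].
    assert (Z : forall c d, c <= d -> d <= a \/ b <= c -> is_RInt f c d 0).
    { intros c d hcd ho. apply is_RInt_ext with (fun _ => 0).
      - rewrite Rmin_left, Rmax_right by exact hcd.
        intros s hs; symmetry; apply h; lra.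
      - pose proof (is_RInt_const c d (0 : R)) as K.
        change (scal (d - c) 0) with ((d - c) * 0) in K.
        rewrite Rmult_0_r in K; exact K. }
    pose proof (Z x a ltac:(lra) ltac:(lra)) as Z1.
    pose proof (Z b y ltac:(lra) ltac:(lra)) as Z2.
    assert (Z3 : is_RInt f a b (RInt f a b)).
    { apply (RInt_correct f), (ex_RInt_continuous f); auto. }
    pose proof (is_RInt_Chasles _ _ _ _ _ _ (is_RInt_Chasles _ _ _ _ _ _ Z1 Z3) Z2) as K.
    change (plus (plus 0 (RInt f a b)) 0) with (0 + RInt f a b + 0) in K.
    rewrite Rplus_0_l, Rplus_0_r in K; exact K.
Qed.

Definition vanishes_outside (M : R) (f : R -> R) : Prop :=
  forall x, M < Rabs x -> f x = 0.

Lemma vanishes_outside_derive (M : R) (f f' : R -> R) :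
  (forall x, is_derive f x (f' x)) ->
  vanishes_outside M f -> vanishes_outside M f'.
Proof.
  intros d v x hx.
  rewrite <- (is_derive_unique f x _ (d x)).
  rewrite <- (Derive_const 0 x). apply Derive_ext_loc.
  assert (h : 0 < Rabs x - M) by lra.
  exists (mkposreal _ h); intros y hy; apply v.
  change (Rabs (y - x) < Rabs x - M) in hy.
  pose proof (Rabs_triang_inv x y); rewrite (Rabs_minus_sym x y) in *; lra.
Qed.

Lemma vanishes_outside_interval (M : R) (f : R -> R) :
  vanishes_outside M f -> forall x, x < - M \/ M < x -> f x = 0.
Proof.
  intros v x hx; apply v.
  pose proof (Rle_abs x); pose proof (Rle_abs (- x)); rewrite Rabs_Ropp in *; lra.
Qed.

(** The integrand is the derivative of
    P phi''' - P' phi'' + P'' phi' - P''' phi, which vanishes at both ends.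
    The margin 1 is there because phi is only known to vanish strictly
    outside [-M, M]. *)
Lemma integral_by_parts4 (P P1 P2 P3 f phi phi1 phi2 phi3 psi : R -> R) (M : R) :
  0 <= M ->
  derivatives4 P P1 P2 P3 f -> derivatives4 phi phi1 phi2 phi3 psi ->
  (forall x, continuous f x) -> (forall x, continuous psi x) ->
  vanishes_outside M phi ->
  is_RInt (fun x => P x * psi x - f x * phi x) (- (M + 1)) (M + 1) 0.
Proof.
  intros hM HP Hphi cf cpsi v.
  assert (v1 := vanishes_outside_derive M _ _ (fun x => proj1 (Hphi x)) v).
  assert (v2 := vanishes_outside_derive M _ _ (fun x => proj1 (proj2 (Hphi x))) v1).
  assert (v3 := vanishes_outside_derive M _ _
                  (fun x => proj1 (proj2 (proj2 (Hphi x)))) v2).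
  set (W := fun x => P x * phi3 x - P1 x * phi2 x + P2 x * phi1 x - P3 x * phi x).
  assert (W0 : forall x, M < Rabs x -> W x = 0).
  { intros x hx; unfold W; rewrite v, v1, v2, v3 by exact hx; ring. }
  assert (dW : forall x, is_derive W x (P x * psi x - f x * phi x)).
  { intro x; destruct (HP x) as [d0 [d1 [d2 d3]]], (Hphi x) as [c0 [c1 [c2 c3]]].
    unfold W; auto_derive.
    - repeat split; eexists; eassumption.
    - change (fun x => P x) with P; change (fun x => P1 x) with P1;
        change (fun x => P2 x) with P2; change (fun x => P3 x) with P3;
        change (fun x => phi x) with phi; change (fun x => phi1 x) with phi1;
        change (fun x => phi2 x) with phi2; change (fun x => phi3 x) with phi3.
      apply is_derive_unique in d0, d1, d2, d3, c0, c1, c2, c3.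
      rewrite d0, d1, d2, d3, c0, c1, c2, c3; ring. }
  assert (K := is_RInt_derive W _ (- (M + 1)) (M + 1) (fun x _ => dW x)).
  rewrite !W0 in K by (try rewrite Rabs_Ropp; rewrite Rabs_pos_eq; lra).
  change (minus 0 0) with (0 - 0) in K; rewrite Rminus_0_r in K; apply K.
  intros x _.
  apply (continuous_minus (fun x => P x * psi x) (fun x => f x * phi x)).
  - apply (continuous_mult P psi); [|apply cpsi].
    exact (continuous_of_derive P x _ (proj1 (HP x))).
  - apply (continuous_mult f phi); [apply cf|].
    exact (continuous_of_derive phi x _ (proj1 (Hphi x))).
Qed.

(** * Smooth functions and mollifiers *)

(** Exhibiting each derivative as a function makes closure under products a
    plain induction, which iterated [Derive_n] would not. *)
Fixpoint differentiable_times (k : nat) (f : R -> R) : Prop :=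
  match k with
  | O => True
  | S k => exists f', (forall x, is_derive f x (f' x)) /\ differentiable_times k f'
  end.

Definition smooth (f : R -> R) : Prop := forall k, differentiable_times k f.

Lemma differentiable_times_S (k : nat) (f : R -> R) :
  differentiable_times (S k) f -> differentiable_times k f.
Proof.
  revert f; induction k as [|k IH]; intros f [f' [d H]]; [exact I|].
  exists f'; auto.
Qed.

Lemma smooth_continuous (f : R -> R) : smooth f -> forall x, continuous f x.
Proof.
  intros H x; destruct (H 1%nat) as [f' [d _]].
  exact (continuous_of_derive f x _ (d x)).
Qed.

Lemma ex_derive_n_smooth (f : R -> R) :
  smooth f -> forall k x, ex_derive_n f k x.
Proof.
  intros H k; specialize (H k); revert f H.
  induction k as [|k IH]; intros f H x; [exact I|].
  destruct H as [f' [d H]].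
  destruct k as [|k]; [exists (f' x); apply d|].
  apply ex_derive_ext with (Derive_n f' k); [|exact (IH f' H x)].
  intro t; replace (S k) with (k + 1)%nat by lia.
  rewrite <- Derive_n_comp. apply Derive_n_ext; intro s.
  symmetry; apply is_derive_unique, d.
Qed.

Lemma smooth_of_derive (f f' : R -> R) :
  (forall x, is_derive f x (f' x)) -> smooth f' -> smooth f.
Proof. intros d H [|k]; [exact I|exists f'; auto]. Qed.

Lemma differentiable_times_ext (k : nat) (f g : R -> R) :
  (forall x, f x = g x) -> differentiable_times k f -> differentiable_times k g.
Proof.
  destruct k as [|k]; intros e; [intros; exact I|].
  intros [f' [d H]]; exists f'; split; [|exact H].
  intro x; exact (is_derive_ext f g x _ e (d x)).
Qed.

Lemma differentiable_times_const (k : nat) (c : R) :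
  differentiable_times k (fun _ => c).
Proof.
  revert c; induction k as [|k IH]; intro c; [exact I|].
  exists (fun _ => 0); split; [intro x; apply (is_derive_const c)|apply IH].
Qed.

Lemma differentiable_times_plus (k : nat) (f g : R -> R) :
  differentiable_times k f -> differentiable_times k g ->
  differentiable_times k (fun x => f x + g x).
Proof.
  revert f g; induction k as [|k IH]; intros f g; [intros; exact I|].
  intros [f' [df Hf]] [g' [dg Hg]].
  exists (fun x => f' x + g' x); split; [|auto].
  intro x; exact (is_derive_plus f g x _ _ (df x) (dg x)).
Qed.

Lemma differentiable_times_mult (k : nat) (f g : R -> R) :
  differentiable_times k f -> differentiable_times k g ->
  differentiable_times k (fun x => f x * g x).
Proof.
  revert f g; induction k as [|k IH]; intros f g; [intros; exact I|].
  intros Hf Hg.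
  assert (Hf0 := differentiable_times_S _ _ Hf).
  assert (Hg0 := differentiable_times_S _ _ Hg).
  destruct Hf as [f' [df Hf]]; destruct Hg as [g' [dg Hg]].
  exists (fun x => f' x * g x + f x * g' x); split.
  - intro x; exact (is_derive_mult f g x _ _ (df x) (dg x) Rmult_comm).
  - apply differentiable_times_plus; auto.
Qed.

Lemma differentiable_times_affine (k : nat) (f : R -> R) (a b : R) :
  differentiable_times k f -> differentiable_times k (fun x => f (a * x + b)).
Proof.
  revert f; induction k as [|k IH]; intros f; [intros; exact I|].
  intros [f' [df Hf]].
  exists (fun x => a * f' (a * x + b)); split.
  - intro x; apply is_derive_affine, df.
  - apply (differentiable_times_mult k (fun _ => a));
      [apply differentiable_times_const|auto].
Qed.

Lemma smooth_minus_scal (f g : R -> R) (c : R) :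
  smooth f -> smooth g -> smooth (fun x => f x - c * g x).
Proof.
  intros hf hg k.
  apply differentiable_times_ext with (fun x => f x + - c * g x).
  - intro x; ring.
  - apply differentiable_times_plus; [apply hf|].
    apply (differentiable_times_mult k (fun _ => - c));
      [apply differentiable_times_const|apply hg].
Qed.

Lemma smooth_translate (f : R -> R) (z : R) :
  smooth f -> smooth (fun x => f (x - z)).
Proof.
  intros hf k.
  apply differentiable_times_ext with (fun x => f (1 * x + - z)).
  - intro x; f_equal; ring.
  - apply differentiable_times_affine, hf.
Qed.

(** The derivative of x^(-m) exp(-1/x) is a combination of two functions of
    the same family; this is why the powers are carried along. *)
Definition flat (m : nat) (x : R) : R :=
  if Rlt_dec 0 x then (/ x) ^ m * exp (- / x) else 0.

Lemma flat_nonpos (m : nat) (x : R) : x <= 0 -> flat m x = 0.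
Proof. intro h; unfold flat; destruct (Rlt_dec 0 x); [lra|reflexivity]. Qed.

Lemma flat_pos (m : nat) (x : R) : 0 < x -> flat m x = (/ x) ^ m * exp (- / x).
Proof. intro h; unfold flat; destruct (Rlt_dec 0 x); [reflexivity|lra]. Qed.

(** The exponential exp(1/x) is at least the term of degree m + 2 of its
    series. *)
Lemma flat_quadratic (m : nat) (x : R) :
  Rabs (flat m x) <= INR (Factorial.fact (m + 2)) * x ^ 2.
Proof.
  pose proof (INR_fact_lt_0 (m + 2)) as hf.
  destruct (Rlt_or_le 0 x) as [h|h].
  - rewrite flat_pos by exact h.
    assert (hi : 0 < / x) by (apply Rinv_0_lt_compat; exact h).
    rewrite Rabs_pos_eq
      by (apply Rmult_le_pos; [apply pow_le; lra|apply Rlt_le, exp_pos]).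
    pose proof (exp_ge_taylor (/ x) (m + 2) (Rlt_le _ _ hi)) as T.
    assert (K : (/ x) ^ (m + 2) <= INR (Factorial.fact (m + 2)) * exp (/ x)).
    { replace (m + 2)%nat with (S (m + 1)) in * by lia.
      rewrite tech5 in T.
      assert (0 <= sum_f_R0 (fun k => (/ x) ^ k / INR (Factorial.fact k)) (m + 1)).
      { apply cond_pos_sum; intro k. apply Rmult_le_pos; [apply pow_le; lra|].
        apply Rlt_le, Rinv_0_lt_compat, INR_fact_lt_0. }
      apply Rmult_le_reg_l with (/ INR (Factorial.fact (S (m + 1)))).
      - apply Rinv_0_lt_compat; exact hf.
      - rewrite <- Rmult_assoc, Rinv_l, Rmult_1_l by lra.
        unfold Rdiv in *; lra. }
    rewrite exp_Ropp.
    assert (he := exp_pos (/ x)).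
    apply Rmult_le_reg_r with (exp (/ x)); [exact he|].
    replace ((/ x) ^ m * / exp (/ x) * exp (/ x))
      with (x ^ 2 * (/ x) ^ (m + 2)).
    + replace (INR (Factorial.fact (m + 2)) * x ^ 2 * exp (/ x))
        with (x ^ 2 * (INR (Factorial.fact (m + 2)) * exp (/ x))) by ring.
      apply Rmult_le_compat_l; [apply pow2_ge_0|exact K].
    + rewrite pow_add. field; split; lra.
  - rewrite flat_nonpos, Rabs_R0 by exact h.
    pose proof (pow2_ge_0 x); nra.
Qed.

Lemma is_derive_zero_of_quadratic (f : R -> R) (C : R) :
  (forall x, Rabs (f x) <= C * x ^ 2) -> is_derive f 0 0.
Proof.
  intro H. apply is_derive_Reals. intros eps he.
  assert (hC : 0 <= C).
  { pose proof (H 1); pose proof (Rabs_pos (f 1)); lra. }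
  assert (f0 : f 0 = 0).
  { pose proof (H 0) as h; rewrite pow_i, Rmult_0_r in h by lia.
    destruct (Req_dec (f 0) 0) as [|n]; [assumption|].
    apply Rabs_pos_lt in n; lra. }
  assert (hd : 0 < eps / (C + 1)) by (apply Rdiv_lt_0_compat; lra).
  exists (mkposreal _ hd); simpl; intros h h0 hh.
  rewrite Rplus_0_l, f0, !Rminus_0_r.
  assert (ha : 0 < Rabs h) by (apply Rabs_pos_lt; exact h0).
  unfold Rdiv; rewrite Rabs_mult, Rabs_inv.
  apply Rmult_lt_reg_r with (Rabs h); [exact ha|].
  rewrite Rmult_assoc, Rinv_l, Rmult_1_r by lra.
  apply Rle_lt_trans with (C * h ^ 2); [apply H|].
  rewrite <- (pow2_abs h).
  apply (Rmult_lt_compat_r (C + 1)) in hh; [|lra].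
  replace (eps / (C + 1) * (C + 1)) with eps in hh by (field; lra).
  simpl. nra.
Qed.

Lemma is_derive_flat (m : nat) (x : R) :
  is_derive (flat m) x (flat (S (S m)) x + - INR m * flat (S m) x).
Proof.
  destruct (total_order_T 0 x) as [[h|<-]|h].
  - apply is_derive_ext_loc with (fun x => (/ x) ^ m * exp (- / x)).
    + exists (mkposreal x h); intros y hy.
      apply Rabs_lt_between' in hy; simpl in hy.
      symmetry; apply flat_pos; lra.
    + rewrite !flat_pos by exact h. auto_derive; [repeat split; lra|].
      destruct m as [|m]; simpl pred; [simpl; field; lra|].
      rewrite S_INR. simpl. field; lra.
  - rewrite !flat_nonpos, Rmult_0_r, Rplus_0_r by lra.
    exact (is_derive_zero_of_quadratic _ _ (flat_quadratic m)).
  - apply is_derive_ext_loc with (fun _ => 0).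
    + assert (h' : 0 < - x) by lra.
      exists (mkposreal _ h'); intros y hy.
      apply Rabs_lt_between' in hy; simpl in hy.
      symmetry; apply flat_nonpos; lra.
    + rewrite !flat_nonpos, Rmult_0_r, Rplus_0_r by lra.
      apply (is_derive_const (0 : R)).
Qed.

Lemma smooth_flat (m : nat) : smooth (flat m).
Proof.
  intro k; revert m; induction k as [|k IH]; intro m; [exact I|].
  exists (fun x => flat (S (S m)) x + - INR m * flat (S m) x).
  split; [apply is_derive_flat|].
  apply differentiable_times_plus; [apply IH|].
  apply (differentiable_times_mult k (fun _ => - INR m));
    [apply differentiable_times_const|apply IH].
Qed.

Lemma ex_mollifier (eps : R) :
  0 < eps ->
  exists rho, smooth rho /\ (forall x, 0 <= rho x) /\
    (forall x, eps <= Rabs x -> rho x = 0) /\ RInt rho (- eps) eps = 1.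
Proof.
  intro he.
  set (b := fun x => flat 0 (-1 * x + eps) * flat 0 (1 * x + eps)).
  assert (hs : smooth b).
  { intro k; apply (differentiable_times_mult k (fun x => flat 0 (-1 * x + eps)));
      apply differentiable_times_affine, smooth_flat. }
  assert (hf : forall x, 0 <= flat 0 x /\ (0 < x -> 0 < flat 0 x)).
  { intro x; destruct (Rlt_or_le 0 x) as [h|h].
    - rewrite flat_pos by exact h; pose proof (exp_pos (- / x)); simpl; lra.
    - rewrite flat_nonpos by exact h; lra. }
  assert (hI : 0 < RInt b (- eps) eps).
  { apply RInt_gt_0; [lra| |].
    - intros x hx; apply Rmult_lt_0_compat; apply hf; lra.
    - intros x _; apply smooth_continuous, hs. }
  exists (fun x => / RInt b (- eps) eps * b x).
  repeat split.
  - intro k; apply (differentiable_times_mult k (fun _ => / RInt b (- eps) eps));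
      [apply differentiable_times_const|apply hs].
  - intro x; apply Rmult_le_pos; [apply Rlt_le, Rinv_0_lt_compat, hI|].
    apply Rmult_le_pos; apply hf.
  - intros x hx; unfold b.
    destruct (Rcase_abs x) as [h|h].
    + rewrite Rabs_left in hx by exact h.
      rewrite (flat_nonpos 0 (1 * x + eps)) by lra; ring.
    + rewrite Rabs_right in hx by exact h.
      rewrite (flat_nonpos 0 (-1 * x + eps)) by lra; ring.
  - apply is_RInt_unique.
    replace 1 with (scal (/ RInt b (- eps) eps) (RInt b (- eps) eps)).
    + apply (is_RInt_scal b), (RInt_correct b), (ex_RInt_continuous b).
      intros x _; apply smooth_continuous, hs.
    + apply Rinv_l; lra.
Qed.

(** Integration against the translated mollifier is an average of u over
    [z - eps, z + eps]. *)
Lemma mollified_value (u rho : R -> R) (z eps eta M : R) :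
  0 < eps -> (forall x, continuous u x) -> (forall x, continuous rho x) ->
  (forall x, 0 <= rho x) -> vanishes_outside eps rho ->
  RInt rho (- eps) eps = 1 ->
  (forall x, Rabs (x - z) <= eps -> Rabs (u x - u z) <= eta) ->
  0 <= eta -> Rabs z + eps <= M ->
  Rabs (RInt (fun x => u x * rho (x - z)) (- M) M - u z) <= eta.
Proof.
  intros he cu cr hr v h1 hu heta hM.
  assert (hz : - Rabs z <= z <= Rabs z) by (apply Rabs_le_between, Rle_refl).
  assert (crz : forall x, continuous (fun x => rho (x - z)) x).
  { intro x; apply (continuous_comp (fun x => x - z) rho); [|apply cr].
    apply (continuous_minus (fun x => x) (fun _ => z));
      [apply continuous_id|apply continuous_const]. }
  assert (I1 : is_RInt (fun x => rho (x - z)) (- M) M 1).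
  { rewrite <- h1.
    replace (RInt rho (- eps) eps) with (RInt rho (1 * - M + - z) (1 * M + - z)).
    - apply is_RInt_ext with (fun x => scal 1 (rho (1 * x + - z))).
      + intros x _. change (1 * rho (1 * x + - z) = rho (x - z)).
        rewrite Rmult_1_l; f_equal; ring.
      + apply (is_RInt_comp_lin rho), (RInt_correct rho), (ex_RInt_continuous rho).
        auto.
    - rewrite <- (integral_line_eq_RInt rho (- eps) eps),
        <- (integral_line_eq_RInt rho (1 * - M + - z) (1 * M + - z)); auto; try lra.
      + intros x hx; apply (vanishes_outside_interval eps _ v); lra.
      + apply (vanishes_outside_interval eps _ v). }
  assert (I2 : is_RInt (fun x => u x * rho (x - z)) (- M) M
                 (RInt (fun x => u x * rho (x - z)) (- M) M)).
  { apply (RInt_correct (fun x => u x * rho (x - z))),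
      (ex_RInt_continuous (fun x => u x * rho (x - z))).
    intros x _; apply (continuous_mult u (fun x => rho (x - z))); auto. }
  assert (I3 : forall c, is_RInt (fun x => c * rho (x - z)) (- M) M c).
  { intro c; pose proof (is_RInt_scal _ _ _ c _ I1) as K.
    change (scal c 1) with (c * 1) in K; rewrite Rmult_1_r in K; exact K. }
  apply (norm_RInt_le (fun x => u x * rho (x - z) - u z * rho (x - z))
           (fun x => eta * rho (x - z)) (- M) M).
  - lra.
  - intros x _.
    change (Rabs (u x * rho (x - z) - u z * rho (x - z)) <= eta * rho (x - z)).
    rewrite <- Rmult_minus_distr_r, Rabs_mult, (Rabs_pos_eq (rho _)) by auto.
    destruct (Rle_or_lt (Rabs (x - z)) eps) as [h|h].
    + apply Rmult_le_compat_r; auto.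
    + rewrite v by exact h; lra.
  - exact (is_RInt_minus _ _ _ _ _ _ I2 (I3 (u z))).
  - apply I3.
Qed.

(** * Weak solutions are classical *)

Definition lagrange0 (y : R) := - (y - 1) * (y - 2) * (y - 3) / 6.

Definition lagrange1 (y : R) := y * (y - 2) * (y - 3) / 2.

Definition lagrange2 (y : R) := - y * (y - 1) * (y - 3) / 2.

Definition lagrange3 (y : R) := y * (y - 1) * (y - 2) / 6.

(** The operator u |-> u(y) - sum_j l_j(y) u(j), where l_0, ..., l_3 is the
    Lagrange basis at the nodes 0, 1, 2, 3.  The functions u that it kills for
    every y are the polynomials of degree at most 3. *)
Definition interpolation_error (u : R -> R) (y : R) : R :=
  u y - lagrange0 y * u 0 - lagrange1 y * u 1 - lagrange2 y * u 2
  - lagrange3 y * u 3.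

Lemma smooth_interpolation_kernel (rho : R -> R) (y : R) :
  smooth rho -> smooth (fun x => interpolation_error (fun z => rho (x - z)) y).
Proof.
  intro hs.
  assert (Ts := fun z => smooth_translate rho z hs).
  repeat (apply (smooth_minus_scal _ (fun x => rho (x - _))); [|apply Ts]).
  apply Ts.
Qed.

Lemma interpolation_error_RInt (k : R -> R -> R) (y a b : R) :
  (forall z, ex_RInt (k z) a b) ->
  is_RInt (fun x => interpolation_error (fun z => k z x) y) a b
    (interpolation_error (fun z => RInt (k z) a b) y).
Proof.
  intro h.
  assert (I := fun z => RInt_correct (k z) a b (h z)).
  assert (L := fun l z f (v : R) (Hf : is_RInt f a b v) =>
    is_RInt_minus f _ a b v _ Hf (is_RInt_scal (k z) a b l _ (I z))).
  exact (L (lagrange3 y) 3 _ _ (L (lagrange2 y) 2 _ _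
            (L (lagrange1 y) 1 _ _ (L (lagrange0 y) 0 _ _ (I y))))).
Qed.

(** A primitive taken from the left of the support is 0 there, and has zero
    fourth derivative, hence is cubic, to the right of it. *)
Lemma primitive4_cubic_beyond_support (eps : R) (rho : R -> R) :
  0 < eps -> (forall x, continuous rho x) -> vanishes_outside eps rho ->
  exists r r1 r2 r3 a b c d,
    derivatives4 r r1 r2 r3 rho /\
    (forall x, x < - eps -> r x = 0) /\
    (forall x, eps < x -> r x = a + b * x + c * x ^ 2 + d * x ^ 3).
Proof.
  intros he hc v.
  destruct (ex_primitive4 rho (- eps) hc) as [r [r1 [r2 [r3 [H [e0 [e1 [e2 e3]]]]]]]].
  assert (Hm := derivatives4_affine _ _ _ _ _ (-1) 0 H).
  exists r, r1, r2, r3,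
    (r eps - eps * r1 eps + eps ^ 2 / 2 * r2 eps - eps ^ 3 / 6 * r3 eps),
    (r1 eps - eps * r2 eps + eps ^ 2 / 2 * r3 eps),
    (r2 eps / 2 - eps / 2 * r3 eps), (r3 eps / 6).
  split; [exact H|split]; intros x hx.
  (* Taylor's formula is forward; on the left it is applied to the reflection. *)
  - destruct (taylor4 _ _ _ _ _ eps (- x - eps) Hm) as [z [hz e]]; [lra|].
    replace (-1 * (eps + (- x - eps)) + 0) with x in e by ring.
    replace (-1 * eps + 0) with (- eps) in e by ring.
    rewrite e, e0, e1, e2, e3, (v (-1 * z + 0)); [ring|].
    rewrite Rabs_left; lra.
  - destruct (taylor4 _ _ _ _ _ eps (x - eps) H) as [z [hz e]]; [lra|].
    replace (eps + (x - eps)) with x in e by ring.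
    rewrite e, (v z); [field|].
    rewrite Rabs_pos_eq; lra.
Qed.

(** Let r be the fourfold primitive of rho that is 0 on the left.  Apply the
    interpolation error at y to z |-> r(x - z).  For x far to the left every
    term is 0; for x far to the right the function of z is a cubic polynomial,
    which the interpolation error kills.  The result is therefore a test
    function of x, with the wanted fourth derivative, without any condition on
    the moments of rho. *)
Lemma ex_interpolation_test_function (y eps : R) (rho : R -> R) :
  0 < eps -> smooth rho -> vanishes_outside eps rho ->
  exists phi phi1 phi2 phi3,
    smooth phi /\ vanishes_outside (Rabs y + 3 + eps) phi /\
    derivatives4 phi phi1 phi2 phi3
      (fun x => interpolation_error (fun z => rho (x - z)) y).
Proof.
  intros he hs v.
  destruct (primitive4_cubic_beyond_support eps rho he
              (smooth_continuous rho hs) v)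
    as [r [r1 [r2 [r3 [a [b [c [d [H [hl hr]]]]]]]]]].
  assert (T := fun z => derivatives4_translate _ _ _ _ _ z H).
  assert (L := fun l z f f1 f2 f3 f4 Hf =>
    derivatives4_minus_scal f f1 f2 f3 f4 _ _ _ _ _ l Hf (T z)).
  assert (hsr : smooth r).
  { apply smooth_of_derive with r1; [intro x; apply H|].
    apply smooth_of_derive with r2; [intro x; apply H|].
    apply smooth_of_derive with r3; [intro x; apply H|].
    apply smooth_of_derive with rho; [intro x; apply H|exact hs]. }
  assert (Ts := fun z => smooth_translate r z hsr).
  assert (Ls := fun l z f Hf => smooth_minus_scal f _ l Hf (Ts z)).
  exists (fun x => interpolation_error (fun z => r (x - z)) y).
  eexists; eexists; eexists; split; [|split].
  - exact (Ls (lagrange3 y) 3 _ (Ls (lagrange2 y) 2 _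
            (Ls (lagrange1 y) 1 _ (Ls (lagrange0 y) 0 _ (Ts y))))).
  - intros x hx.
    assert (hy : - Rabs y <= y <= Rabs y) by (apply Rabs_le_between, Rle_refl).
    unfold interpolation_error.
    destruct (Rcase_abs x) as [h|h].
    + rewrite (Rabs_left x) in hx by exact h.
      rewrite !hl by lra; ring.
    + rewrite (Rabs_right x) in hx by exact h.
      rewrite !hr by lra.
      unfold lagrange0, lagrange1, lagrange2, lagrange3; field.
  - exact (L (lagrange3 y) 3 _ _ _ _ _ (L (lagrange2 y) 2 _ _ _ _ _
            (L (lagrange1 y) 1 _ _ _ _ _ (L (lagrange0 y) 0 _ _ _ _ _ (T y))))).
Qed.

(** Letting the mollifier concentrate in the test functions of
    [ex_interpolation_test_function], the mollified values of u at y and at the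
    nodes tend to those of u. *)
Lemma cubic_of_annihilating (u : R -> R) :
  (forall x, continuous u x) ->
  (forall phi phi1 phi2 phi3 psi M, 0 <= M ->
     smooth phi -> vanishes_outside M phi -> smooth psi ->
     derivatives4 phi phi1 phi2 phi3 psi ->
     RInt (fun x => u x * psi x) (- (M + 1)) (M + 1) = 0) ->
  forall y, interpolation_error u y = 0.
Proof.
  intros cu hann y.
  set (S := 1 + Rabs (lagrange0 y) + Rabs (lagrange1 y) + Rabs (lagrange2 y)
            + Rabs (lagrange3 y)).
  assert (hS : 0 < S).
  { pose proof (Rabs_pos (lagrange0 y)); pose proof (Rabs_pos (lagrange1 y));
      pose proof (Rabs_pos (lagrange2 y)); pose proof (Rabs_pos (lagrange3 y));
      unfold S; lra. }
  assert (key : forall eta, 0 < eta -> Rabs (interpolation_error u y) <= eta * S).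
  { intros eta heta.
    assert (hc : forall z, exists eps, 0 < eps /\
              forall x, Rabs (x - z) <= eps -> Rabs (u x - u z) <= eta).
    { intro z.
      destruct (cu z (ball (u z) (mkposreal eta heta))
                  (locally_ball (u z) (mkposreal eta heta))) as [d hd].
      exists (d / 2); pose proof (cond_pos d); split; [lra|].
      intros x hx; apply Rlt_le, (hd x).
      change (Rabs (x - z) < d); lra. }
    destruct (hc y) as [e [he ue]].
    destruct (hc 0) as [e0 [he0 ue0]]; destruct (hc 1) as [e1 [he1 ue1]];
      destruct (hc 2) as [e2 [he2 ue2]]; destruct (hc 3) as [e3 [he3 ue3]].
    set (eps := Rmin e (Rmin (Rmin e0 e1) (Rmin e2 e3))).
    assert (heps : 0 < eps) by (unfold eps; repeat apply Rmin_pos; assumption).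
    assert (hle : eps <= e /\ eps <= e0 /\ eps <= e1 /\ eps <= e2 /\ eps <= e3).
    { pose proof (Rmin_l e (Rmin (Rmin e0 e1) (Rmin e2 e3)));
        pose proof (Rmin_r e (Rmin (Rmin e0 e1) (Rmin e2 e3)));
        pose proof (Rmin_l (Rmin e0 e1) (Rmin e2 e3));
        pose proof (Rmin_r (Rmin e0 e1) (Rmin e2 e3));
        pose proof (Rmin_l e0 e1); pose proof (Rmin_r e0 e1);
        pose proof (Rmin_l e2 e3); pose proof (Rmin_r e2 e3);
        unfold eps; repeat split; lra. }
    destruct (ex_mollifier eps heps) as [rho [hs [hp [hv h1]]]].
    assert (v : vanishes_outside eps rho) by (intros x hx; apply hv; lra).
    destruct (ex_interpolation_test_function y eps rho heps hs v)
      as [phi [phi1 [phi2 [phi3 [sphi [vphi dphi]]]]]].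
    set (M := Rabs y + 3 + eps) in *.
    pose proof (Rabs_pos y) as hy.
    assert (cr := smooth_continuous rho hs).
    (* A z is the mollification of u at z. *)
    set (A := fun z => RInt (fun x => u x * rho (x - z)) (- (M + 1)) (M + 1)).
    assert (hA : forall z d, eps <= d ->
       (forall x, Rabs (x - z) <= d -> Rabs (u x - u z) <= eta) ->
       Rabs z <= Rabs y + 3 -> - eta <= A z - u z <= eta).
    { intros z d hd hz hzM; apply Rabs_le_between.
      apply (mollified_value u rho z eps eta (M + 1)); auto; try lra.
      - intros x hx; apply hz; lra.
      - unfold M; lra. }
    assert (eA : interpolation_error A y = 0).
    { assert (cz : forall z x, continuous (fun x => rho (x - z)) x).
      { intros z x; apply smooth_continuous, smooth_translate, hs. }
      rewrite <- (hann phi phi1 phi2 phi3 _ M ltac:(unfold M; lra) sphi vphi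
                    (smooth_interpolation_kernel rho y hs) dphi).
      symmetry; apply is_RInt_unique.
      eapply is_RInt_ext; [|apply (interpolation_error_RInt
         (fun z x => u x * rho (x - z)) y (- (M + 1)) (M + 1))].
      - intros x _; unfold interpolation_error; simpl; ring.
      - intro z; apply (ex_RInt_continuous (fun x => u x * rho (x - z))).
        intros x _; apply (continuous_mult u (fun x => rho (x - z))); auto. }
    assert (a3 : forall c, 0 <= c <= 3 -> Rabs c <= Rabs y + 3)
      by (intros c hc0; rewrite Rabs_pos_eq; lra).
    pose proof (hA y e ltac:(lra) ue ltac:(lra)) as b.
    pose proof (hA 0 e0 ltac:(lra) ue0 (a3 0 ltac:(lra))) as b0.
    pose proof (hA 1 e1 ltac:(lra) ue1 (a3 1 ltac:(lra))) as b1.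
    pose proof (hA 2 e2 ltac:(lra) ue2 (a3 2 ltac:(lra))) as b2.
    pose proof (hA 3 e3 ltac:(lra) ue3 (a3 3 ltac:(lra))) as b3.
    assert (Q : forall l t, - eta <= t <= eta ->
              - (Rabs l * eta) <= l * t <= Rabs l * eta).
    { intros l t ht; apply Rabs_le_between; rewrite Rabs_mult.
      apply Rmult_le_compat_l; [apply Rabs_pos|apply Rabs_le; exact ht]. }
    apply (Q (lagrange0 y)) in b0; apply (Q (lagrange1 y)) in b1;
      apply (Q (lagrange2 y)) in b2; apply (Q (lagrange3 y)) in b3.
    unfold interpolation_error in *; unfold S.
    apply Rabs_le; lra. }
  destruct (Req_dec (interpolation_error u y) 0) as [|hne]; [assumption|exfalso].
  apply Rabs_pos_lt in hne.
  specialize (key (Rabs (interpolation_error u y) / (2 * S))).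
  replace (Rabs (interpolation_error u y) / (2 * S) * S)
    with (Rabs (interpolation_error u y) / 2) in key by (field; lra).
  assert (0 < Rabs (interpolation_error u y) / (2 * S))
    by (apply Rdiv_lt_0_compat; lra).
  specialize (key ltac:(assumption)); lra.
Qed.

(** If P is a fourfold primitive of f, then F - P annihilates the fourth
    derivatives of test functions, so it is a cubic polynomial. *)
Lemma classical_of_weak (F f : R -> R) :
  (forall x, continuous F x) -> (forall x, continuous f x) ->
  (forall phi, test_function phi ->
     integral_line (fun x => F x * Derive_n phi 4 x) =
     integral_line (fun x => f x * phi x)) ->
  exists F1 F2 F3, derivatives4 F F1 F2 F3 f.
Proof.
  intros cF cf hweak.
  destruct (ex_primitive4 f 0 cf) as [P [P1 [P2 [P3 [HP _]]]]].
  assert (cP : forall x, continuous P x)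
    by (intro x; exact (continuous_of_derive P x _ (proj1 (HP x)))).
  set (u := fun x => F x - P x).
  assert (cu : forall x, continuous u x)
    by (intro x; apply (continuous_minus F P); auto).
  assert (E : forall y, interpolation_error u y = 0).
  { apply cubic_of_annihilating; [exact cu|].
    intros phi phi1 phi2 phi3 psi M hM sphi vphi spsi dphi.
    assert (cpsi := smooth_continuous psi spsi).
    assert (cphi := smooth_continuous phi sphi).
    assert (ephi := proj2 (proj2 (proj2 (derivatives4_Derive_n _ _ _ _ _ dphi)))).
    assert (vpsi : vanishes_outside M psi).
    { apply vanishes_outside_derive with phi3; [intro x; apply dphi|].
      apply vanishes_outside_derive with phi2; [intro x; apply dphi|].
      apply vanishes_outside_derive with phi1; [intro x; apply dphi|].
      apply vanishes_outside_derive with phi; [intro x; apply dphi|exact vphi]. }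
    assert (V : forall k g, vanishes_outside M g -> forall x,
              x < - (M + 1) \/ M + 1 < x -> k x * g x = 0).
    { intros k g hg x hx; rewrite (vanishes_outside_interval M g hg); lra. }
    assert (C : forall (k g : R -> R), (forall x, continuous k x) ->
              (forall x, continuous g x) -> forall x, continuous (fun x => k x * g x) x)
      by (intros k g ck cg x; apply (continuous_mult k g); auto).
    assert (hw := hweak phi (conj (ex_derive_n_smooth phi sphi)
       (compactly_supported_of_vanishing phi _ _
          (vanishes_outside_interval M phi vphi)))).
    assert (e1 : integral_line (fun x => F x * Derive_n phi 4 x)
                 = RInt (fun x => F x * psi x) (- (M + 1)) (M + 1)).
    { rewrite (integral_line_eq_RInt _ (- (M + 1)) (M + 1)); [| |lra|].
      - apply RInt_ext; intros x _; rewrite ephi; reflexivity.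
      - intros x hx; rewrite ephi; apply V; auto.
      - intro x; apply continuous_ext with (fun x => F x * psi x).
        + intro t; rewrite ephi; reflexivity.
        + apply C; auto. }
    rewrite e1, (integral_line_eq_RInt _ (- (M + 1)) (M + 1)) in hw;
      [|apply V; auto|lra|apply C; auto].
    assert (X : forall k g : R -> R, (forall x, continuous k x) ->
       (forall x, continuous g x) ->
       is_RInt (fun x => k x * g x) (- (M + 1)) (M + 1)
         (RInt (fun x => k x * g x) (- (M + 1)) (M + 1))).
    { intros k g ck cg; apply (RInt_correct (fun x => k x * g x)),
        (ex_RInt_continuous (fun x => k x * g x)); intros x _; apply C; auto. }
    pose proof (integral_by_parts4 _ _ _ _ _ _ _ _ _ _ M hM HP dphi cf cpsi vphi) as I0.
    pose proof (is_RInt_minus _ _ _ _ _ _ (X F psi cF cpsi) (X f phi cf cphi)) as I1.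
    pose proof (is_RInt_minus _ _ _ _ _ _ I1 I0) as I2.
    apply is_RInt_unique.
    replace 0 with (minus (minus (RInt (fun x => F x * psi x) (- (M + 1)) (M + 1))
      (RInt (fun x => f x * phi x) (- (M + 1)) (M + 1))) 0).
    - apply is_RInt_ext with (2 := I2).
      intros x _; unfold u.
      change (F x * psi x - f x * phi x - (P x * psi x - f x * phi x)
              = (F x - P x) * psi x); ring.
    - rewrite hw; change (RInt (fun x => f x * phi x) (- (M + 1)) (M + 1)
         - RInt (fun x => f x * phi x) (- (M + 1)) (M + 1) - 0 = 0); ring. }
  (* The coefficients of the cubic with values u 0, ..., u 3 at the nodes. *)
  set (b := - 11 / 6 * u 0 + 3 * u 1 - 3 / 2 * u 2 + / 3 * u 3).
  set (c := u 0 - 5 / 2 * u 1 + 2 * u 2 - / 2 * u 3).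
  set (d := - / 6 * u 0 + / 2 * u 1 - / 2 * u 2 + / 6 * u 3).
  assert (eF : forall y, P y + (u 0 + b * y + c * y ^ 2 + d * y ^ 3) = F y).
  { intro y; specialize (E y).
    unfold interpolation_error, lagrange0, lagrange1, lagrange2, lagrange3 in E.
    assert (e : u y = F y - P y) by reflexivity.
    unfold b, c, d; lra. }
  exists (fun y => P1 y + (b + 2 * c * y + 3 * d * y ^ 2)),
         (fun y => P2 y + (2 * c + 6 * d * y)), (fun y => P3 y + 6 * d).
  intro y; destruct (HP y) as [d0 [d1 [d2 d3]]].
  split; [|split; [|split]].
  - apply is_derive_ext with (1 := eF).
    apply (is_derive_plus P); [exact d0|auto_derive; [exact I|ring]].
  - apply (is_derive_plus P1); [exact d1|auto_derive; [exact I|ring]].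
  - apply (is_derive_plus P2); [exact d2|auto_derive; [exact I|ring]].
  - rewrite <- (Rplus_0_r (f y)).
    apply (is_derive_plus P3); [exact d3|auto_derive; [exact I|ring]].
Qed.

(** * The nonlinearity *)

Lemma nonlinearity_opp (n u : R) : nonlinearity n (- u) = - nonlinearity n u.
Proof. unfold nonlinearity; rewrite Rabs_Ropp, sign_opp; ring. Qed.

(** The exponent is (1 - alpha)/2 for alpha = 1/(n+1), and
    u^2 = |u|^(1-alpha) |u|^(1+alpha).  The point is that the factor is small
    for small mu: this is where the sublinearity of the nonlinearity enters. *)
Lemma square_le_nonlinearity (n u mu : R) :
  0 < n -> Rabs u <= mu ->
  u ^ 2 <= Rpower mu (n / (n + 1) / 2) ^ 2 * (u * nonlinearity n u).
Proof.
  intros hn hu.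
  destruct (Req_dec u 0) as [->|hu0]; [lra|].
  assert (ha : 0 < Rabs u) by (apply Rabs_pos_lt; exact hu0).
  assert (es : u * nonlinearity n u = Rabs u * Rpower (Rabs u) (/ (n + 1))).
  { unfold nonlinearity; destruct (Rlt_or_le u 0) as [h|h].
    - rewrite sign_eq_m1, (Rabs_left u) by exact h; ring.
    - rewrite sign_eq_1, (Rabs_pos_eq u) by lra; ring. }
  set (p := n / (n + 1) / 2).
  assert (hp : 0 < p) by (unfold p; repeat apply Rdiv_lt_0_compat; lra).
  assert (hm : Rpower (Rabs u) p <= Rpower mu p) by (apply Rle_Rpower_l; lra).
  assert (e : u ^ 2 = Rpower (Rabs u) p ^ 2 * (u * nonlinearity n u)).
  { rewrite es.
    replace (Rpower (Rabs u) p ^ 2 * (Rabs u * Rpower (Rabs u) (/ (n + 1))))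
      with (Rabs u * (Rpower (Rabs u) p * Rpower (Rabs u) p
                      * Rpower (Rabs u) (/ (n + 1)))) by ring.
    rewrite <- !Rpower_plus.
    replace (p + p + / (n + 1)) with 1 by (unfold p; field; lra).
    rewrite Rpower_1 by exact ha.
    rewrite <- (pow2_abs u); ring. }
  rewrite e at 1. apply Rmult_le_compat_r.
  - rewrite es; apply Rmult_le_pos; [lra|apply Rlt_le, exp_pos].
  - apply pow_incr; split; [apply Rlt_le, exp_pos|exact hm].
Qed.

Lemma nonlinearity_small (n eps : R) :
  0 < n -> 0 < eps ->
  exists mu, 0 < mu /\ forall u, Rabs u <= mu -> Rabs (nonlinearity n u) <= eps.
Proof.
  intros hn he.
  exists (Rpower eps (n + 1)); split; [apply exp_pos|].
  intros u hu; unfold nonlinearity.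
  destruct (Req_dec u 0) as [->|hu0].
  { rewrite sign_0, Rmult_0_r, Rabs_R0; lra. }
  assert (ha : 0 < Rabs u) by (apply Rabs_pos_lt; exact hu0).
  assert (hs : Rabs (sign u) = 1).
  { destruct (Rlt_or_le u 0).
    - rewrite sign_eq_m1, Rabs_left by lra; lra.
    - rewrite sign_eq_1, Rabs_R1 by lra; reflexivity. }
  rewrite Rabs_mult, hs, Rmult_1_r, Rabs_pos_eq by (apply Rlt_le, exp_pos).
  replace eps with (Rpower (Rpower eps (n + 1)) (/ (n + 1))).
  - apply Rle_Rpower_l; [|lra].
    apply Rlt_le, Rinv_0_lt_compat; lra.
  - rewrite Rpower_mult, Rinv_r, Rpower_1; lra.
Qed.

Lemma continuous_nonlinearity (n u : R) : 0 < n -> continuous (nonlinearity n) u.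
Proof.
  intro hn.
  assert (P : forall x, 0 < x -> continuous (nonlinearity n) x).
  { intros x hx.
    apply continuous_ext_loc with (fun y => exp (/ (n + 1) * ln y)).
    - exists (mkposreal x hx); intros y hy.
      apply Rabs_lt_between' in hy; simpl in hy.
      unfold nonlinearity, Rpower.
      rewrite sign_eq_1, (Rabs_pos_eq y), Rmult_1_r by lra; reflexivity.
    - eapply continuous_of_derive; auto_derive; [exact hx|reflexivity]. }
  destruct (total_order_T 0 u) as [[h|<-]|h].
  - exact (P u h).
  - apply filterlim_locally; intro eps.
    pose proof (cond_pos eps) as he.
    destruct (nonlinearity_small n (eps / 2) hn) as [mu [hmu hg]]; [lra|].
    exists (mkposreal mu hmu); intros y hy.
    change (Rabs (y - 0) < mu) in hy; rewrite Rminus_0_r in hy.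
    change (Rabs (nonlinearity n y - nonlinearity n 0) < eps).
    replace (nonlinearity n 0) with 0
      by (unfold nonlinearity; rewrite sign_0; ring).
    rewrite Rminus_0_r; specialize (hg y (Rlt_le _ _ hy)); lra.
  - apply continuous_ext with (fun y => - nonlinearity n (- y)).
    + intro y; rewrite nonlinearity_opp; apply Ropp_involutive.
    + apply (continuous_opp (fun y => nonlinearity n (- y))).
      apply (continuous_comp (fun y => - y) (nonlinearity n)).
      * eapply continuous_of_derive; auto_derive; [exact I|reflexivity].
      * apply P; lra.
Qed.

(** * Decay at infinity *)

(** Non-strict inequalities fit the Taylor estimates and monotonicity
    arguments better than the filter form of the same limit. *)
Definition vanishes_at_p_infty (f : R -> R) : Prop :=
  forall eps, 0 < eps -> exists Y, forall y, Y <= y -> Rabs (f y) <= eps.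

Lemma vanishing_right_hand_side (n : R) (F : R -> R) :
  0 < n -> vanishes_at_p_infty F ->
  vanishes_at_p_infty (fun y => F y - nonlinearity n (F y)).
Proof.
  intros hn hF eps he.
  destruct (nonlinearity_small n (eps / 2) hn) as [mu [hmu hg]]; [lra|].
  destruct (hF (Rmin mu (eps / 2))) as [Y HY]; [apply Rmin_pos; lra|].
  exists Y; intros y hy; specialize (HY y hy).
  assert (h1 := Rmin_l mu (eps / 2)); assert (h2 := Rmin_r mu (eps / 2)).
  assert (h3 := hg (F y) ltac:(lra)).
  unfold Rminus; eapply Rle_trans; [apply Rabs_triang|].
  rewrite Rabs_Ropp; lra.
Qed.

(** Taylor's formula at y with steps 1, 2, 3 is an invertible linear system
    for the three intermediate derivatives at y, whose right-hand side is made
    of values of f and f4 beyond y. *)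
Lemma vanishing_derivatives (f f1 f2 f3 f4 : R -> R) :
  derivatives4 f f1 f2 f3 f4 ->
  vanishes_at_p_infty f -> vanishes_at_p_infty f4 ->
  vanishes_at_p_infty f1 /\ vanishes_at_p_infty f2 /\ vanishes_at_p_infty f3.
Proof.
  intros H h0 h4.
  assert (K : forall eps, 0 < eps -> exists Y, forall y, Y <= y ->
     Rabs (f1 y) <= eps /\ Rabs (f2 y) <= eps /\ Rabs (f3 y) <= eps).
  { intros eps he.
    destruct (h0 (eps / 1000)) as [Y0 H0]; [lra|].
    destruct (h4 (eps / 1000)) as [Y4 H4]; [lra|].
    exists (Rmax Y0 Y4); intros y hy.
    assert (hy0 := Rmax_l Y0 Y4); assert (hy4 := Rmax_r Y0 Y4).
    destruct (taylor4 f f1 f2 f3 f4 y 1 H) as [z1 [hz1 e1]]; [lra|].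
    destruct (taylor4 f f1 f2 f3 f4 y 2 H) as [z2 [hz2 e2]]; [lra|].
    destruct (taylor4 f f1 f2 f3 f4 y 3 H) as [z3 [hz3 e3]]; [lra|].
    assert (A : forall z, y <= z -> - (eps / 1000) <= f z <= eps / 1000)
      by (intros; apply Rabs_le_between, H0; lra).
    assert (B : forall z, y <= z -> - (eps / 1000) <= f4 z <= eps / 1000)
      by (intros; apply Rabs_le_between, H4; lra).
    pose proof (A y); pose proof (A (y + 1)); pose proof (A (y + 2));
      pose proof (A (y + 3)).
    pose proof (B z1); pose proof (B z2); pose proof (B z3).
    (* Linear elimination: the loss is below the factor 1000. *)
    repeat split; apply Rabs_le; lra. }
  repeat split; intros eps he; destruct (K eps he) as [Y HY]; exists Y;
    intros y hy; apply HY; exact hy.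
Qed.

Lemma nonneg_of_nonincreasing_vanishing (G : R -> R) (Y : R) :
  (forall x y, Y <= x <= y -> G y <= G x) -> vanishes_at_p_infty G ->
  forall y, Y <= y -> 0 <= G y.
Proof.
  intros hdec hlim y hy. apply Rnot_lt_le; intro h.
  destruct (hlim (- G y / 2)) as [Z hZ]; [lra|].
  specialize (hZ (Rmax y Z) (Rmax_r _ _)).
  apply Rabs_le_between in hZ.
  assert (G (Rmax y Z) <= G y) by (apply hdec; split; [exact hy|apply Rmax_l]).
  lra.
Qed.

(** * Energy estimates and extinction *)

(** Let K = f1^2 - f f2, so that K' = - G and K'' = D, with G = f f3 - f1 f2 and
    D = f2^2 - f f4.  For a weight w, moving two derivatives from K to w, and then,
    since K = (f f1)' - 2 f f2 and f f1 = (f^2)'/2, two more, gives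

      w D = (boundary term)' - 2 w'' f f2 + w'''' f^2 / 2.

    The weight is the polynomial of degree 7 that rises from 0 at y to 1 at
    y + t with three vanishing derivatives at both ends, so that the boundary
    term is 0 at y and - G at y + t; its derivatives of order 2 and 4 are at
    most 5040 t^(-2) and 52920 t^(-4).  The integrals are avoided by proving
    that the boundary term minus a multiple of G is nondecreasing. *)
Lemma cutoff_inequality (f f1 f2 f3 f4 : R -> R) (y t sigma : R) :
  derivatives4 f f1 f2 f3 f4 ->
  0 < t <= 1 -> 0 < sigma ->
  (forall s, y <= s <= y + t ->
     f s ^ 2 <= 2 * sigma * (f2 s ^ 2 - f s * f4 s) /\
     Rabs (f s * f2 s) <= sigma * (f2 s ^ 2 - f s * f4 s)) ->
  0 <= f (y + t) * f3 (y + t) - f1 (y + t) * f2 (y + t) ->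
  t ^ 4 * (f (y + t) * f3 (y + t) - f1 (y + t) * f2 (y + t))
    <= 63000 * sigma * (f y * f3 y - f1 y * f2 y).
Proof.
  intros H ht hs hb hG.
  set (l := / t).
  assert (hl : 1 <= l).
  { unfold l; rewrite <- Rinv_1; apply Rinv_le_contravar; lra. }
  assert (hlt : l * t = 1) by (unfold l; field; lra).
  (* w is the cutoff; w1, ..., w4 are its successive derivatives. *)
  set (w := fun s => 35 * ((s - y) * l) ^ 4 - 84 * ((s - y) * l) ^ 5
                     + 70 * ((s - y) * l) ^ 6 - 20 * ((s - y) * l) ^ 7).
  set (w1 := fun s => l * (140 * ((s - y) * l) ^ 3 - 420 * ((s - y) * l) ^ 4
                     + 420 * ((s - y) * l) ^ 5 - 140 * ((s - y) * l) ^ 6)).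
  set (w2 := fun s => l ^ 2 * (420 * ((s - y) * l) ^ 2 - 1680 * ((s - y) * l) ^ 3
                     + 2100 * ((s - y) * l) ^ 4 - 840 * ((s - y) * l) ^ 5)).
  set (w3 := fun s => l ^ 3 * (840 * ((s - y) * l) - 5040 * ((s - y) * l) ^ 2
                     + 8400 * ((s - y) * l) ^ 3 - 4200 * ((s - y) * l) ^ 4)).
  set (w4 := fun s => l ^ 4 * (840 - 10080 * ((s - y) * l)
                     + 25200 * ((s - y) * l) ^ 2 - 16800 * ((s - y) * l) ^ 3)).
  set (G := fun s => f s * f3 s - f1 s * f2 s).
  set (D := fun s => f2 s ^ 2 - f s * f4 s).
  set (M := 63000 * sigma * l ^ 4).
  set (T := fun s => - w s * (f s * f3 s - f1 s * f2 s)
                     - w1 s * (f1 s ^ 2 - f s * f2 s)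
                     + w2 s * (f s * f1 s) - w3 s * (f s ^ 2 / 2)
                     - M * (f s * f3 s - f1 s * f2 s)).
  set (T' := fun s => w s * D s + 2 * w2 s * (f s * f2 s)
                      - w4 s * (f s ^ 2 / 2) + M * D s).
  assert (hT : T y <= T (y + t)).
  { apply nondecreasing_of_derive with T'; [lra| |].
    - intros x _. destruct (H x) as [d0 [d1 [d2 d3]]].
      unfold T, w, w1, w2, w3.
      auto_derive.
      + repeat split; eexists; eassumption.
      + change (fun x => f x) with f; change (fun x => f1 x) with f1;
          change (fun x => f2 x) with f2; change (fun x => f3 x) with f3.
        apply is_derive_unique in d0, d1, d2, d3.
        rewrite d0, d1, d2, d3.
        unfold T', w, w2, w4, D; field.
    - intros x hx.
      destruct (hb x hx) as [b1 b2]. fold (D x) in b1, b2.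
      assert (hD : 0 <= D x).
      { pose proof (pow2_ge_0 (f x)); nra. }
      set (v := (x - y) * l).
      assert (hv : 0 <= v <= 1).
      { unfold v; split; [apply Rmult_le_pos; lra|].
        rewrite <- hlt, (Rmult_comm l); apply Rmult_le_compat_r; lra. }
      assert (p2 : 0 <= v ^ 2 <= 1) by nra.
      assert (p3 : 0 <= v ^ 3 <= 1) by nra.
      assert (p4 : 0 <= v ^ 4 <= 1) by nra.
      assert (p5 : 0 <= v ^ 5 <= 1) by nra.
      assert (L2 : 1 <= l ^ 2) by nra.
      assert (L4 : l ^ 2 <= l ^ 4) by nra.
      (* Taylor expansion of the cutoff divided by v^4, around v = 1. *)
      assert (q0 : 0 <= w x).
      { unfold w; fold v.
        replace (_ - _) with
          (v ^ 4 * (1 + 4 * (1 - v) + 10 * (1 - v) ^ 2 + 20 * (1 - v) ^ 3))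
          by ring.
        assert (0 <= (1 - v) ^ 2) by nra.
        assert (0 <= (1 - v) ^ 3) by nra.
        apply Rmult_le_pos; lra. }
      assert (q2 : Rabs (w2 x) <= 5040 * l ^ 4).
      { unfold w2; fold v; rewrite Rabs_mult, (Rabs_pos_eq (l ^ 2)) by lra.
        rewrite Rmult_comm; apply Rmult_le_compat;
          [apply Rabs_pos|lra|apply Rabs_le; lra|lra]. }
      assert (q4 : Rabs (w4 x) <= 52920 * l ^ 4).
      { unfold w4; fold v; rewrite Rabs_mult, (Rabs_pos_eq (l ^ 4)) by lra.
        rewrite Rmult_comm; apply Rmult_le_compat;
          [apply Rabs_pos|lra|apply Rabs_le; lra|lra]. }
      assert (a2 : Rabs (w2 x * (f x * f2 x)) <= 5040 * l ^ 4 * (sigma * D x)).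
      { rewrite Rabs_mult; apply Rmult_le_compat; auto using Rabs_pos. }
      assert (a4 : Rabs (w4 x * (f x ^ 2 / 2)) <= 52920 * l ^ 4 * (sigma * D x)).
      { rewrite Rabs_mult; apply Rmult_le_compat; auto using Rabs_pos.
        rewrite Rabs_pos_eq; [lra|]. pose proof (pow2_ge_0 (f x)); lra. }
      apply Rabs_le_between in a2; apply Rabs_le_between in a4.
      assert (0 <= w x * D x) by (apply Rmult_le_pos; assumption).
      unfold T', M. lra. }
  assert (e0 : T y = - M * G y).
  { unfold T, w, w1, w2, w3, G; replace (y - y) with 0 by ring; ring. }
  assert (e1 : T (y + t) = - G (y + t) - M * G (y + t)).
  { unfold T, w, w1, w2, w3, G; replace (y + t - y) with t by ring.
    rewrite (Rmult_comm t l), hlt; ring. }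
  rewrite e0, e1 in hT. fold (G (y + t)) in hG |- *. fold (G y).
  assert (hM : 0 <= M).
  { unfold M. assert (0 < l ^ 4) by (apply pow_lt; lra). nra. }
  assert (K : G (y + t) <= M * G y) by nra.
  replace (63000 * sigma * G y) with (t ^ 4 * (M * G y)).
  - apply Rmult_le_compat_l; [apply pow_le; lra|exact K].
  - unfold M, l; field; lra.
Qed.

(** Let m = |F(y)|.  As |F'| <= 1, |F| >= m/2 on [y, y + m/2], which costs
    at least (m/2) (m/2)^2 / 2 = m^3 / 16 of G. *)
Lemma cube_le_energy (F F1 G D : R -> R) (Y : R) :
  (forall y, Y <= y -> is_derive F y (F1 y) /\ is_derive G y (- D y)) ->
  (forall y, Y <= y -> Rabs (F1 y) <= 1 /\ 0 <= G y /\ F y ^ 2 <= 2 * D y) ->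
  forall y, Y <= y -> Rabs (F y) ^ 3 <= 16 * G y.
Proof.
  intros hd hb y hy.
  destruct (Req_dec (F y) 0) as [e|hne].
  { rewrite e, Rabs_R0. destruct (hb y hy) as [_ [hG _]]. lra. }
  set (m := Rabs (F y)).
  assert (hm : 0 < m) by (apply Rabs_pos_lt; exact hne).
  assert (hcont : forall s, Y <= s -> continuity_pt F s /\ continuity_pt G s).
  { intros s hs; destruct (hd s hs) as [d1 d2]; split;
      apply continuity_pt_filterlim; eapply continuous_of_derive; eassumption. }
  destruct (MVT_gen G y (y + m / 2) (fun s => - D s)) as [z [hz e]].
  - rewrite Rmin_left, Rmax_right by lra; intros; apply hd; lra.
  - rewrite Rmin_left, Rmax_right by lra; intros; apply hcont; lra.
  - rewrite Rmin_left, Rmax_right in hz by lra.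
    destruct (MVT_gen F y z F1) as [c [hc e']].
    + rewrite Rmin_left, Rmax_right by lra; intros; apply hd; lra.
    + rewrite Rmin_left, Rmax_right by lra; intros; apply hcont; lra.
    + rewrite Rmin_left, Rmax_right in hc by lra.
      destruct (hb c ltac:(lra)) as [b1 _].
      destruct (hb z ltac:(lra)) as [_ [_ b2]].
      destruct (hb (y + m / 2) ltac:(lra)) as [_ [b3 _]].
      assert (h1 : Rabs (F z - F y) <= m / 2).
      { rewrite e', Rabs_mult, (Rabs_pos_eq (z - y)) by lra.
        pose proof (Rabs_pos (F1 c)); nra. }
      assert (h2 : m / 2 <= Rabs (F z)).
      { pose proof (Rabs_triang_inv (F y) (F y - F z)) as h.
        replace (F y - (F y - F z)) with (F z) in h by ring.
        rewrite (Rabs_minus_sym (F y) (F z)) in h. fold m in h. lra. }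
      assert (h3 : (m / 2) ^ 2 <= F z ^ 2).
      { rewrite <- (pow2_abs (F z)). apply pow_incr; lra. }
      nra.
Qed.

(** Start at a point Z where G <= d and iterate along
    y_k = Z + 1 - 2^(-k), so that t = 2^(-k-1) and t^4 costs a factor 16^(k+1).
    The bound G(y_k) <= d r^k propagates if r^q = 1/16, for then the superlinear
    gain r^(k q) pays for 16^k, and if d is small enough to absorb 16 C / r.
    Hence G(Z + 1) <= d r^k for all k. *)
Lemma superlinear_decay_vanishes (G : R -> R) (Y C q : R) :
  0 < C -> 0 < q ->
  (forall y, Y <= y -> 0 <= G y) ->
  (forall x y, Y <= x <= y -> G y <= G x) ->
  vanishes_at_p_infty G ->
  (forall y t, Y <= y -> 0 < t <= 1 -> 0 < G y ->
     t ^ 4 * G (y + t) <= C * Rpower (G y) q * G y) ->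
  exists Z, Y <= Z /\ G Z = 0.
Proof.
  intros hC hq hpos hdec hlim hrec.
  set (r := Rpower (/ 16) (/ q)).
  assert (hr0 : 0 < r) by apply exp_pos.
  assert (hr1 : r < 1).
  { unfold r, Rpower. rewrite <- exp_0. apply exp_increasing.
    rewrite ln_Rinv by lra.
    assert (0 < ln 16) by (rewrite <- ln_1; apply ln_increasing; lra).
    assert (0 < / q) by (apply Rinv_0_lt_compat; lra). nra. }
  set (d := Rpower (r / (16 * C)) (/ q)).
  assert (hd : 0 < d) by apply exp_pos.
  destruct (hlim d hd) as [Z0 hZ0].
  set (Z := Rmax Y Z0).
  assert (hZY : Y <= Z) by apply Rmax_l.
  exists (Z + 1); split; [lra|].
  destruct (Rle_lt_or_eq_dec 0 (G (Z + 1))) as [hp|]; [apply hpos; lra| |auto].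
  exfalso.
  assert (hq1 : forall x, 0 < x -> Rpower (Rpower x (/ q)) q = x).
  { intros x hx; rewrite Rpower_mult, Rinv_l, Rpower_1; lra. }
  assert (rq : forall k, Rpower (r ^ k) q = (/ 16) ^ k).
  { induction k as [|k IH]; simpl.
    - unfold Rpower; rewrite ln_1, Rmult_0_r; apply exp_0.
    - rewrite <- Rpower_mult_distr, IH by (auto using pow_lt).
      f_equal; apply hq1; lra. }
  assert (hk : forall k, G (Z + 1 - (/ 2) ^ k) <= d * r ^ k).
  { induction k as [|k IH].
    - simpl. replace (Z + 1 - 1) with Z by ring. rewrite Rmult_1_r.
      eapply Rle_trans; [apply Rle_abs|apply hZ0, Rmax_r].
    - set (y := Z + 1 - (/ 2) ^ k) in *.
      set (t := (/ 2) ^ S k).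
      assert (ht : 0 < (/ 2) ^ k <= 1).
      { split; [apply pow_lt; lra|].
        rewrite <- (pow1 k); apply pow_incr; lra. }
      assert (et : t = / 2 * (/ 2) ^ k) by reflexivity.
      assert (hyt : Z + 1 - t = y + t) by (rewrite et; unfold y; lra).
      rewrite hyt.
      assert (hy : 0 < G y).
      { apply Rlt_le_trans with (1 := hp); apply hdec; unfold y; lra. }
      assert (hy2 : Y <= y) by (unfold y; lra).
      pose proof (hrec y t hy2 ltac:(lra) hy) as K.
      assert (hdr : 0 < d * r ^ k) by (apply Rmult_lt_0_compat; auto using pow_lt).
      assert (P : Rpower (G y) q <= Rpower (d * r ^ k) q).
      { apply Rle_Rpower_l; lra. }
      assert (Pe : Rpower (d * r ^ k) q = r / (16 * C) * (/ 16) ^ k).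
      { rewrite <- Rpower_mult_distr, rq by (auto using pow_lt).
        unfold d; rewrite hq1; [reflexivity|].
        apply Rdiv_lt_0_compat; lra. }
      assert (t4 : t ^ 4 = / 16 * (/ 16) ^ k).
      { unfold t. rewrite <- pow_mult, Nat.mul_comm, pow_mult.
        replace ((/ 2) ^ 4) with (/ 16) by field. reflexivity. }
      assert (hs : 0 < (/ 16) ^ k) by (apply pow_lt; lra).
      assert (K2 : t ^ 4 * G (y + t) <= C * (r / (16 * C) * (/ 16) ^ k) * (d * r ^ k)).
      { eapply Rle_trans; [exact K|]. rewrite <- Pe.
        apply Rmult_le_compat; [| lra | |exact IH].
        - apply Rmult_le_pos; [lra|apply Rlt_le, exp_pos].
        - apply Rmult_le_compat_l; lra. }
      apply Rmult_le_reg_l with (t ^ 4); [rewrite t4; lra|].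
      eapply Rle_trans; [exact K2|]. rewrite t4. simpl. right. field. lra. }
  assert (hk2 : forall k, G (Z + 1) <= d * r ^ k).
  { intro k; eapply Rle_trans; [|apply hk].
    assert (ht : 0 < (/ 2) ^ k <= 1).
    { split; [apply pow_lt; lra|].
      rewrite <- (pow1 k); apply pow_incr; lra. }
    apply hdec; lra. }
  destruct (pow_lt_1_zero r) with (y := G (Z + 1) / d) as [N hN].
  - rewrite Rabs_pos_eq; lra.
  - apply Rdiv_lt_0_compat; lra.
  - specialize (hN N (le_n _)). specialize (hk2 N).
    rewrite Rabs_pos_eq in hN by (apply pow_le; lra).
    apply (Rmult_lt_compat_l d) in hN; [|lra].
    replace (d * (G (Z + 1) / d)) with (G (Z + 1)) in hN by (field; lra).
    lra.
Qed.

Lemma Rabs_le_of_square_le (x y : R) : 0 <= y -> x ^ 2 <= y ^ 2 -> Rabs x <= y.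
Proof. intros; apply Rabs_le; split; nra. Qed.

Lemma Rpower_le_1 (x p : R) : 0 < x <= 1 -> 0 <= p -> Rpower x p <= 1.
Proof.
  intros hx hp.
  replace 1 with (Rpower 1 p)
    by (unfold Rpower; rewrite ln_1, Rmult_0_r; apply exp_0).
  apply Rle_Rpower_l; assumption.
Qed.

(** The two estimates relating sup |F| and the energy G are combined into the
    hypothesis of [superlinear_decay_vanishes]; see the introduction. *)
Lemma extinction_at_infinity (n : R) (F F1 F2 F3 : R -> R) :
  0 < n ->
  derivatives4 F F1 F2 F3 (fun y => F y - nonlinearity n (F y)) ->
  vanishes_at_p_infty F ->
  exists Z, forall y, Z <= y -> F y = 0.
Proof.
  intros hn H h0.
  destruct (vanishing_derivatives _ _ _ _ _ H h0
              (vanishing_right_hand_side n F hn h0)) as [h1 [h2 h3]].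
  set (F4 := fun y => F y - nonlinearity n (F y)) in *.
  set (G := fun y => F y * F3 y - F1 y * F2 y).
  set (D := fun y => F2 y ^ 2 - F y * F4 y).
  assert (hG' : forall y, is_derive G y (- D y)).
  { intro y; destruct (H y) as [d0 [d1 [d2 d3]]]; unfold G.
    auto_derive.
    - repeat split; eexists; eassumption.
    - change (fun x => F x) with F; change (fun x => F1 x) with F1;
        change (fun x => F2 x) with F2; change (fun x => F3 x) with F3.
      apply is_derive_unique in d0, d1, d2, d3.
      rewrite d0, d1, d2, d3; unfold D; ring. }
  assert (hGlim : vanishes_at_p_infty G).
  { intros eps he.
    set (e := Rmin 1 (eps / 2)).
    assert (he0 : 0 < e) by (apply Rmin_pos; lra).
    assert (he1 : e <= 1) by apply Rmin_l.
    assert (he2 : e <= eps / 2) by apply Rmin_r.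
    destruct (h0 e he0) as [Y0 H0]; destruct (h1 e he0) as [Y1 H1];
      destruct (h2 e he0) as [Y2 H2]; destruct (h3 e he0) as [Y3 H3].
    exists (Rmax (Rmax Y0 Y1) (Rmax Y2 Y3)); intros y hy.
    assert (Y0 <= y /\ Y1 <= y /\ Y2 <= y /\ Y3 <= y).
    { pose proof (Rmax_l Y0 Y1); pose proof (Rmax_r Y0 Y1);
        pose proof (Rmax_l Y2 Y3); pose proof (Rmax_r Y2 Y3);
        pose proof (Rmax_l (Rmax Y0 Y1) (Rmax Y2 Y3));
        pose proof (Rmax_r (Rmax Y0 Y1) (Rmax Y2 Y3)); repeat split; lra. }
    assert (K : forall a b, Rabs a <= e -> Rabs b <= e -> Rabs (a * b) <= eps / 2).
    { intros a b ha hb; rewrite Rabs_mult.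
      pose proof (Rabs_pos a); pose proof (Rabs_pos b); nra. }
    pose proof (K (F y) (F3 y) (H0 y ltac:(lra)) (H3 y ltac:(lra))) as k1.
    pose proof (K (F1 y) (F2 y) (H1 y ltac:(lra)) (H2 y ltac:(lra))) as k2.
    apply Rabs_le_between in k1; apply Rabs_le_between in k2.
    apply Rabs_le; unfold G; lra. }
  set (p := n / (n + 1) / 2).
  assert (hp : 0 < p) by (unfold p; repeat apply Rdiv_lt_0_compat; lra).
  (* mu0^p = 1/2 makes F^2 at most a quarter of F g(F) when |F| <= mu0. *)
  set (mu0 := Rpower (/ 2) (/ p)).
  assert (hmu0 : 0 < mu0) by apply exp_pos.
  assert (emu0 : Rpower mu0 p = / 2).
  { unfold mu0; rewrite Rpower_mult, Rinv_l, Rpower_1; lra. }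
  destruct (h0 mu0 hmu0) as [Y0 H0].
  destruct (h1 1 Rlt_0_1) as [Y1 H1].
  destruct (hGlim (/ 16)) as [Y2 H2]; [lra|].
  set (Y := Rmax Y0 (Rmax Y1 Y2)).
  assert (hY : Y0 <= Y /\ Y1 <= Y /\ Y2 <= Y).
  { pose proof (Rmax_l Y0 (Rmax Y1 Y2)); pose proof (Rmax_r Y0 (Rmax Y1 Y2));
    pose proof (Rmax_l Y1 Y2); pose proof (Rmax_r Y1 Y2); unfold Y; lra. }
  set (e := fun y => F y * nonlinearity n (F y)).
  assert (hDe : forall y, D y = F2 y ^ 2 + e y - F y ^ 2)
    by (intro y; unfold D, e, F4; ring).
  assert (he : forall y, Y <= y -> 4 * F y ^ 2 <= e y).
  { intros y hy.
    pose proof (square_le_nonlinearity n (F y) mu0 hn (H0 y ltac:(lra))) as h.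
    fold p in h; rewrite emu0 in h; fold (e y) in h; lra. }
  assert (hD : forall y, Y <= y -> (F2 y ^ 2 + e y) / 2 <= D y).
  { intros y hy; rewrite hDe; specialize (he y hy).
    pose proof (pow2_ge_0 (F2 y)); pose proof (pow2_ge_0 (F y)); lra. }
  assert (hDF : forall y, Y <= y -> F y ^ 2 <= 2 * D y).
  { intros y hy; specialize (hD y hy); specialize (he y hy).
    pose proof (pow2_ge_0 (F2 y)); pose proof (pow2_ge_0 (F y)); lra. }
  assert (hdec : forall x y, Y <= x <= y -> G y <= G x).
  { intros x y hxy.
    assert (- G x <= - G y); [|lra].
    apply (nondecreasing_of_derive (fun s => - G s) D x y); [lra| |].
    - intros s hs. pose proof (is_derive_opp G s _ (hG' s)) as d.
      change (opp (- D s)) with (- - D s) in d.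
      rewrite Ropp_involutive in d; exact d.
    - intros s hs; specialize (hDF s ltac:(lra)).
      pose proof (pow2_ge_0 (F s)); lra. }
  assert (hpos := nonneg_of_nonincreasing_vanishing G Y hdec hGlim).
  assert (hcube : forall y, Y <= y -> Rabs (F y) ^ 3 <= 16 * G y).
  { apply (cube_le_energy F F1 G D Y).
    - intros y _; split; [apply H|apply hG'].
    - intros y hy; split; [apply H1; lra|]; auto. }
  destruct (superlinear_decay_vanishes G Y (63000 * Rpower 16 (p / 3)) (p / 3))
    as [Z [hZ eZ]]; auto.
  - pose proof (exp_pos (p / 3 * ln 16)); unfold Rpower; lra.
  - lra.
  - intros y t hy ht hGy.
    (* By the cubic bound, mu dominates |F| beyond y. *)
    set (mu := Rpower (16 * G y) (/ 3)).
    assert (hmu : 0 < mu) by apply exp_pos.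
    assert (mu3 : mu ^ 3 = 16 * G y).
    { rewrite <- Rpower_pow by exact hmu; unfold mu; rewrite Rpower_mult.
      replace (/ 3 * INR 3) with 1 by (simpl; field).
      apply Rpower_1; lra. }
    assert (hmu1 : mu <= 1).
    { apply Rpower_le_1; [|lra].
      pose proof (H2 y ltac:(lra)) as h; apply Rabs_le_between in h; lra. }
    set (sigma := Rpower mu p).
    assert (hs : 0 < sigma) by apply exp_pos.
    assert (hs1 : sigma <= 1) by (apply Rpower_le_1; lra).
    assert (es : sigma = Rpower 16 (p / 3) * Rpower (G y) (p / 3)).
    { unfold sigma, mu; rewrite Rpower_mult, Rpower_mult_distr by lra.
      f_equal; field. }
    replace (63000 * Rpower 16 (p / 3) * Rpower (G y) (p / 3) * G y)
      with (63000 * sigma * G y) by (rewrite es; ring).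
    apply (cutoff_inequality F F1 F2 F3 F4); auto; [|apply hpos; lra].
    intros s hys. fold (D s).
    assert (hF : Rabs (F s) <= mu).
    { apply Rnot_lt_le; intro h.
      assert (Rabs (F s) ^ 3 <= mu ^ 3).
      { rewrite mu3; eapply Rle_trans; [apply hcube; lra|].
        assert (G s <= G y) by (apply hdec; lra). lra. }
      assert (mu ^ 2 < Rabs (F s) ^ 2) by nra. nra. }
    pose proof (square_le_nonlinearity n (F s) mu hn hF) as b.
    fold p in b; fold sigma in b; fold (e s) in b.
    specialize (hD s ltac:(lra)); specialize (he s ltac:(lra)).
    pose proof (pow2_ge_0 (F s)) as q0; pose proof (pow2_ge_0 (F2 s)) as q2.
    split.
    + assert (sigma ^ 2 * e s <= sigma * e s).
      { apply Rmult_le_compat_r; [lra|nra]. }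
      assert (sigma * e s <= sigma * (2 * D s))
        by (apply Rmult_le_compat_l; lra).
      lra.
    (* (F F'')^2 <= sigma^2 e F''^2 and the arithmetic-geometric mean. *)
    + apply Rle_trans with (sigma * ((F2 s ^ 2 + e s) / 2));
        [|apply Rmult_le_compat_l; lra].
      apply Rabs_le_of_square_le; [apply Rmult_le_pos; lra|].
      apply Rle_trans with (sigma ^ 2 * e s * F2 s ^ 2).
      * replace ((F s * F2 s) ^ 2) with (F s ^ 2 * F2 s ^ 2) by ring.
        apply Rmult_le_compat_r; assumption.
      * replace ((sigma * ((F2 s ^ 2 + e s) / 2)) ^ 2)
          with (sigma ^ 2 * ((F2 s ^ 2 + e s) / 2) ^ 2) by ring.
        rewrite Rmult_assoc; apply Rmult_le_compat_l; [apply pow2_ge_0|].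
        pose proof (pow2_ge_0 (F2 s ^ 2 - e s)); lra.
  - exists Z; intros y hy.
    assert (h : Rabs (F y) ^ 3 <= 0).
    { eapply Rle_trans; [apply hcube; lra|].
      assert (G y <= G Z) by (apply hdec; lra). lra. }
    destruct (Req_dec (F y) 0) as [|hne]; [assumption|exfalso].
    apply Rabs_pos_lt, (pow_lt _ 3) in hne; lra.
Qed.

(** * Compactness of the support *)

Theorem proposition5p1 (n : R) (F : R -> R)
  (hn : 0 < n)
  (hcont : forall y : R, continuous F y)
  (hweak : weak_solution n F)
  (hlim_p : is_lim F p_infty 0)
  (hlim_m : is_lim F m_infty 0) :
  compactly_supported F.
Proof.
  destruct (classical_of_weak F (fun y => F y - nonlinearity n (F y)))
    as [F1 [F2 [F3 H]]]; [exact hcont| |exact hweak|].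
  { intro y; apply (continuous_minus F (fun y => nonlinearity n (F y)));
      [apply hcont|].
    apply (continuous_comp F (nonlinearity n));
      [apply hcont|apply continuous_nonlinearity, hn]. }
  apply is_lim_spec in hlim_p; apply is_lim_spec in hlim_m.
  destruct (extinction_at_infinity n F F1 F2 F3 hn H) as [Zp hZp].
  { intros eps he; destruct (hlim_p (mkposreal eps he)) as [Y HY].
    exists (Y + 1); intros y hy; specialize (HY y ltac:(lra)).
    rewrite Rminus_0_r in HY; apply Rlt_le, HY. }
  destruct (extinction_at_infinity n (fun x => F (-1 * x + 0))
              (fun x => -1 * F1 (-1 * x + 0)) (fun x => (-1) ^ 2 * F2 (-1 * x + 0))
              (fun x => (-1) ^ 3 * F3 (-1 * x + 0)) hn) as [Zm hZm].
  { intro x; destruct (derivatives4_affine _ _ _ _ _ (-1) 0 H x)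
      as [d0 [d1 [d2 d3]]].
    split; [exact d0|split; [exact d1|split; [exact d2|]]].
    replace ((-1) ^ 4) with 1 in d3 by ring.
    rewrite Rmult_1_l in d3; exact d3. }
  { intros eps he; destruct (hlim_m (mkposreal eps he)) as [Y HY].
    exists (1 - Y); intros y hy; specialize (HY (-1 * y + 0) ltac:(lra)).
    rewrite Rminus_0_r in HY; apply Rlt_le, HY. }
  apply compactly_supported_of_vanishing with (- Zm) Zp.
  intros y [hy|hy]; [|apply hZp; lra].
  replace y with (-1 * - y + 0) by ring; apply hZm; lra.
Qed.
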